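(* The subset ${\cal M}_{\mathbb R}\subset{\cal M}^{\theta}$ is open and is defined in ${\cal M}^\theta$ by a system of strict real polynomial inequalities.
   Context: Let $V=\mathbb C^n$ with its standard Hermitian metric, and let $\dagger$ be Hermitian conjugation of operators. Let $\bar{\cal X}$ be the complex affine variety of all configurations, i.e. pairs of systems of rank 1 projectors $\{p_i\}_{i=1}^n$, $\{q_j\}_{j=1}^n$ in $V$ with $p_ip_{i'}=0$ for $i\neq i'$, $q_jq_{j'}=0$ for $j\neq j'$ and $\mathrm{Tr}\,p_iq_j=\frac1n$ for all $i,j$. Let ${\cal X}\subset\bar{\cal X}$ be the open subvariety of smooth points and ${\cal M}={\cal X}/GL(V)$ the quotient by simultaneous conjugation; it is an open subset of the affine GIT quotient $\bar{\cal X}/GL(V)$. The anti-holomorphic involution $p_i\mapsto p_i^\dagger$, $q_j\mapsto q_j^\dagger$ of ${\cal X}$ descends to an involution $\theta$ of ${\cal M}$; ${\cal M}^\theta$ is its fixed locus. Let ${\cal X}_{\mathbb R}\subset{\cal X}$ be the locus of configurations consisting of Hermitian projectors, and ${\cal M}_{\mathbb R}={\cal X}_{\mathbb R}/U(n)$ (the moduli space of pairs of mutually unbiased bases), which is embedded in ${\cal M}^\theta$. *)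

(* Defs.v *)
From HB Require Import structures.
From mathcomp Require Import all_boot all_order all_algebra.
From mathcomp Require Import all_classical all_reals all_analysis.
From mathcomp Require Import complex.
From mathcomp Require mpoly. (* not imported: its notations clash with analysis *)
Import Order.TTheory GRing.Theory Num.Theory numFieldNormedType.Exports.

Set Implicit Arguments.
Unset Strict Implicit.
Unset Printing Implicit Defensive.

Local Open Scope ring_scope.
Local Open Scope classical_set_scope.
Local Open Scope sesquilinear_scope.

Section AffineVariety.
Variables (K : fieldType) (N : nat).
Implicit Types (x v : 'rV[K]_N) (S Z : set 'rV[K]_N) (f : mpoly.mpoly N K).

Definition peval f x : K := mpoly.meval (fun k => x ord0 k) f.

Definition zero_locus (I : set (mpoly.mpoly N K)) : set 'rV[K]_N :=
  [set x | forall f, I f -> peval f x = 0].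

Definition vanishing_ideal S : set (mpoly.mpoly N K) :=
  [set f | forall x, S x -> peval f x = 0].

Definition zariski_closed Z := exists I, Z = zero_locus I.

Definition irreducible_closed Z :=
  [/\ zariski_closed Z, Z !=set0 &
      forall A B, zariski_closed A -> zariski_closed B ->
        Z `<=` A `|` B -> Z `<=` A \/ Z `<=` B].

Definition closed_chain S x d := exists Z : nat -> set 'rV[K]_N,
  (forall i, (i <= d)%N -> [/\ irreducible_closed (Z i), Z i `<=` S & Z i x]) /\
  (forall i, (i < d)%N -> Z i `<` Z i.+1).

(* The Krull dimension of the local ring of S at x: its primes correspond to
   the irreducible closed subsets of S through x. *)
Definition local_dim S x d :=
  closed_chain S x d /\ forall e, closed_chain S x e -> (e <= d)%N.

Definition tangent_space S x : set 'rV[K]_N :=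
  [set v | forall f, vanishing_ideal S f ->
     \sum_(k < N) peval (mpoly.mderiv k f) x * v ord0 k = 0].

Definition tangent_dim S x d := exists2 B : 'M[K]_(d, N),
  row_free B & forall v, tangent_space S x v <-> (v <= B)%MS.

Definition smooth_point S x :=
  S x /\ exists2 d, local_dim S x d & tangent_dim S x d.

End AffineVariety.

Section Configurations.
Variables (R : realType) (n : nat).
Local Notation C := R[i].

Definition projsys := (('I_n -> 'M[C]_n) * ('I_n -> 'M[C]_n))%type.
Implicit Types (x y : projsys) (m : set projsys) (g u : 'M[C]_n).

Definition rank1_projector (p : 'M[C]_n) := p *m p = p /\ \rank p = 1%N.

Definition configurations : set projsys :=
  [set x | [/\ (forall i, rank1_projector (x.1 i))
                 /\ (forall j, rank1_projector (x.2 j)),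
               forall i i', i != i' -> x.1 i *m x.1 i' = 0,
               forall j j', j != j' -> x.2 j *m x.2 j' = 0
             & forall i j, \tr (x.1 i *m x.2 j) = n%:R^-1]].

Definition coords x : 'rV[C]_(n * (n * n) + n * (n * n)) :=
  row_mx (mxvec (\matrix_i mxvec (x.1 i))) (mxvec (\matrix_j mxvec (x.2 j))).

Definition smooth_configurations : set projsys :=
  [set x | configurations x /\
           smooth_point (coords @` configurations) (coords x)].

Definition conj_by g x : projsys :=
  (fun i => g *m x.1 i *m invmx g, fun j => g *m x.2 j *m invmx g).

Definition adjoint x : projsys := (fun i => (x.1 i)^t*, fun j => (x.2 j)^t*).

Definition GL_orbit x : set projsys :=
  [set conj_by g x | g in [set g | g \in unitmx]].

Definition U_orbit x : set projsys :=
  [set conj_by u x | u in [set u | u \is unitarymx]].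

(* The points of the affine GIT quotient are the GL-orbits: a configuration is
   an irreducible family of operators (each tr (p_i q_j) is nonzero), so all
   GL-orbits are closed. *)
Definition git_quotient : set (set projsys) := GL_orbit @` configurations.

Definition moduli : set (set projsys) := GL_orbit @` smooth_configurations.

Definition theta m : set projsys := adjoint @` m.

Definition moduli_theta : set (set projsys) :=
  [set m | moduli m /\ theta m = m].

Definition hermitian_configurations : set projsys :=
  [set x | [/\ smooth_configurations x,
               forall i, x.1 i \is hermsymmx & forall j, x.2 j \is hermsymmx]].

Definition moduli_real : set (set projsys) :=
  U_orbit @` hermitian_configurations.

(* The map from U(n)-orbits to GL-orbits embedding moduli_real into
   moduli_theta. *)
Definition GL_saturation m : set projsys := \bigcup_(x in m) GL_orbit x.

Definition moduli_real_in_theta : set (set projsys) :=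
  GL_saturation @` moduli_real.

(* The coordinate ring of the GIT quotient: polynomial functions on
   configurations that are constant on GL-orbits. Values of phi at sets that
   are not orbits of configurations are irrelevant. *)
Definition regular_function (phi : set projsys -> C) :=
  exists f : mpoly.mpoly (n * (n * n) + n * (n * n)) C,
    forall x, configurations x -> phi (GL_orbit x) = peval f (coords x).

(* Regular functions defined over the real numbers for the real structure
   theta; they take real values on moduli_theta. *)
Definition real_regular_function (phi : set projsys -> C) :=
  regular_function phi /\
  forall m, git_quotient m -> phi (theta m) = Num.conj (phi m).

(* The classical topology of the affine GIT quotient: the coarsest one making
   all regular functions continuous. *)
Definition git_topology : topologicalType :=
  sup_topology (fun phi : {phi : set projsys -> C | regular_function phi} =>
    Topological.on (initial_topology (sval phi : _ -> C^o))).

Definition open_in (B A : set (set projsys)) :=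
  exists2 U : set git_topology, open U & A = B `&` U.

End Configurations.

Arguments configurations R n : clear implicits.
Arguments smooth_configurations R n : clear implicits.
Arguments git_quotient R n : clear implicits.
Arguments moduli R n : clear implicits.
Arguments moduli_theta R n : clear implicits.
Arguments hermitian_configurations R n : clear implicits.
Arguments moduli_real R n : clear implicits.
Arguments moduli_real_in_theta R n : clear implicits.

(* Main.v *)
(* Conjugation carrying [x] to its adjoint is an invertible [g] with
   [g p = p^* g] for every projector [p] of [x]. Then [p_i] and [q_j] are
   orthogonal projectors for the form [v^* g w], so [tr (p_i q_j)] is a positive
   multiple of the quotient of the values of the form on the images of [p_i] and
   [q_j]. As these traces are positive, [g] is a scalar multiple of a positive
   definite form [h^* h], and conjugation by [h] makes all projectors Hermitian.
   Hence [moduli_real_in_theta] is all of [moduli_theta], and the empty system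
   of inequalities defines it. *)
Require Import Defs.
From mathcomp Require Import all_boot all_order all_algebra.
From mathcomp Require Import all_classical all_reals all_analysis.
From mathcomp Require Import complex.
From mathcomp Require mpoly.
Import (canonicals, coercions) mpoly.
Import Order.TTheory GRing.Theory Num.Theory.
Set Implicit Arguments.
Unset Strict Implicit.
Unset Printing Implicit Defensive.
Local Open Scope ring_scope.
Local Open Scope classical_set_scope.
Local Open Scope sesquilinear_scope.

(** * Smooth points under an invertible linear change of coordinates *)

Section LinearChange.
Context {K : fieldType} {N : nat}.
Implicit Types (L : 'M[K]_N) (x v : 'rV[K]_N) (S Z : set 'rV[K]_N).
Implicit Types (f : mpoly.mpoly N K).

Definition linear_subst L f : mpoly.mpoly N K :=
  mpoly.comp_mpoly
    [tuple \sum_(k < N) L k j *: mpoly.mpolyX K (mpoly.mnm1 k) | j < N] f.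

Lemma peval_linear_subst L f x : peval (linear_subst L f) x = peval f (x *m L).
Proof.
rewrite /peval /linear_subst mpoly.comp_mpoly_meval.
apply: mpoly.meval_eq => j; rewrite tnth_mktuple mxE raddf_sum /=.
by apply: eq_bigr => k _; rewrite mpoly.mevalZ mpoly.mevalXU mulrC.
Qed.

(** The sum whose vanishing defines [tangent_space]: the derivative of [f] at [x] along [v]. *)
Definition dir_deriv f x v : K :=
  \sum_(k < N) peval (mpoly.mderiv k f) x * v ord0 k.

Lemma dir_derivD f1 f2 x v :
  dir_deriv (f1 + f2) x v = dir_deriv f1 x v + dir_deriv f2 x v.
Proof.
rewrite /dir_deriv -big_split; apply: eq_bigr => k _.
by rewrite mpoly.mderivD /peval mpoly.mevalD mulrDl.
Qed.

Lemma dir_derivZ c f x v : dir_deriv (c *: f) x v = c * dir_deriv f x v.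
Proof.
rewrite /dir_deriv mulr_sumr; apply: eq_bigr => k _.
by rewrite mpoly.mderivZ /peval mpoly.mevalZ mulrA.
Qed.

Lemma dir_derivM f1 f2 x v : dir_deriv (f1 * f2) x v =
  dir_deriv f1 x v * peval f2 x + peval f1 x * dir_deriv f2 x v.
Proof.
rewrite /dir_deriv [peval f1 x * _]mulr_sumr [_ * peval f2 x]mulr_suml.
rewrite -big_split; apply: eq_bigr => k _ /=.
rewrite mpoly.mderivM /peval mpoly.mevalD !mpoly.mevalM.
by rewrite mulrDl mulrA mulrAC.
Qed.

Lemma dir_derivC c x v : dir_deriv (mpoly.mpolyC N c) x v = 0.
Proof.
by apply: big1 => k _; rewrite mpoly.mderivC /peval mpoly.meval0 mul0r.
Qed.

Lemma dir_derivX i x v :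
  dir_deriv (mpoly.mpolyX K (mpoly.mnm1 i)) x v = v ord0 i.
Proof.
rewrite /dir_deriv (bigD1 i) //= big1 => [|k ki].
  by rewrite addr0 mpoly.mderivX mpoly.mnm1E eqxx scale1r -{1}[mpoly.mnm1 i]mpoly.add0m mpoly.addmK
    /peval mpoly.mpolyX0 mpoly.meval1 mul1r.
by rewrite mpoly.mderivX mpoly.mnm1E eq_sym (negbTE ki) scale0r /peval
  mpoly.meval0 mul0r.
Qed.

Lemma dir_deriv_sum (I : Type) (r : seq I) (P : pred I) F x v :
  dir_deriv (\sum_(i <- r | P i) F i) x v =
  \sum_(i <- r | P i) dir_deriv (F i) x v.
Proof.
apply: (big_morph (fun f => dir_deriv f x v)) => [f1 f2|].
  exact: dir_derivD.
by rewrite -(mpoly.mpolyC0 N K) dir_derivC.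
Qed.

(** Chain rule. Both sides are linear in [f] and obey the same product rule, so it is enough to
    compare them on the variables. *)
Lemma dir_deriv_linear_subst L f x v :
  dir_deriv (linear_subst L f) x v = dir_deriv f (x *m L) (v *m L).
Proof.
pose P f := dir_deriv (linear_subst L f) x v = dir_deriv f (x *m L) (v *m L).
have PM f1 f2 : P f1 -> P f2 -> P (f1 * f2).
  rewrite /P => H1 H2.
  by rewrite /linear_subst rmorphM /= -/(linear_subst L f1)
    -/(linear_subst L f2) !dir_derivM H1 H2 !peval_linear_subst.
have P1 : P 1.
  by rewrite /P -(mpoly.mpolyC1 N K) /linear_subst mpoly.comp_mpolyC
    !dir_derivC.
have PX i : P (mpoly.mpolyX K (mpoly.mnm1 i)).
  rewrite /P /linear_subst mpoly.comp_mpolyXU -tnth_nth tnth_mktuple.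
  rewrite dir_deriv_sum dir_derivX mxE; apply: eq_bigr => k _.
  by rewrite dir_derivZ dir_derivX mulrC.
rewrite -/(P f); elim/mpoly.mpolyind: f => [|c m f _ _ Pf].
  by rewrite /P -(mpoly.mpolyC0 N K) /linear_subst mpoly.comp_mpolyC
    !dir_derivC.
rewrite /P /linear_subst raddfD /= mpoly.comp_mpolyZ -!/(linear_subst L _).
rewrite !dir_derivD !dir_derivZ [dir_deriv (linear_subst L f) _ _]Pf.
congr (_ * _ + _).
(* A monomial is a product of powers of variables, and [P] is stable under products. *)
rewrite -/(P _) mpoly.mpolyXE_id; apply: (big_ind P) => // i _.
by elim: (m i) => [|k Pk]; rewrite ?expr0 ?exprS //; apply: PM.
Qed.

Lemma zariski_closed_preimage L Z :
  zariski_closed Z -> zariski_closed ((mulmxr L) @^-1` Z).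
Proof.
case=> I ->; exists [set linear_subst L f | f in I].
rewrite eqEsubset; split=> x /=.
  by move=> H _ [f If <-]; rewrite peval_linear_subst; apply: H.
by move=> H f If; rewrite -peval_linear_subst; apply: H; exists f.
Qed.

Lemma mulmxr_preimageK L L' Z : L *m L' = 1%:M ->
  (mulmxr L) @^-1` ((mulmxr L') @^-1` Z) = Z.
Proof.
move=> LL'; rewrite eqEsubset; split=> x /=; by rewrite -mulmxA LL' mulmx1.
Qed.

(** A closed cover of the preimage pulls back along [L'] to one of [Z]; the inclusion obtained for
    [Z] then pulls back along [L]. *)
Lemma irreducible_closed_preimage L L' Z : L *m L' = 1%:M ->
  irreducible_closed Z -> irreducible_closed ((mulmxr L) @^-1` Z).
Proof.
move=> LL' [cZ [x Zx] irrZ]; have L'L := mulmx1C LL'; split.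
- exact: zariski_closed_preimage.
- by exists (x *m L'); rewrite /= -mulmxA L'L mulmx1.
move=> A B cA cB sub.
have [|||H|H] := irrZ ((mulmxr L') @^-1` A) ((mulmxr L') @^-1` B);
  do ?exact: zariski_closed_preimage.
- move=> y Zy; apply: (sub (y *m L')).
  by rewrite /= -mulmxA L'L mulmx1.
- by left; rewrite -(mulmxr_preimageK A LL') => y /H.
- by right; rewrite -(mulmxr_preimageK B LL') => y /H.
Qed.

(** The point over [x] is [x *m L']. Inclusions stay strict because pulling back along [L'] undoes
    pulling back along [L]. *)
Lemma closed_chain_preimage L L' S x d : L *m L' = 1%:M ->
  closed_chain S x d -> closed_chain ((mulmxr L) @^-1` S) (x *m L') d.
Proof.
move=> LL' [Z [irrZ ltZ]]; have L'L := mulmx1C LL'.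
exists (fun i => (mulmxr L) @^-1` Z i); split=> i ltid.
  have [irr ZS Zx] := irrZ i ltid; split.
  - exact: irreducible_closed_preimage LL' irr.
  - by move=> y /ZS.
  - by rewrite /= -mulmxA L'L mulmx1.
have [sub nsub] := ltZ i ltid; split=> [y /sub //|sub'].
by apply: nsub; rewrite -(mulmxr_preimageK (Z i) L'L) => y Zy; apply: sub';
  rewrite /= -mulmxA L'L mulmx1.
Qed.

Lemma vanishing_ideal_preimage L S f :
  vanishing_ideal S f -> vanishing_ideal ((mulmxr L) @^-1` S) (linear_subst L f).
Proof. by move=> Sf x Sx; rewrite peval_linear_subst; apply: Sf. Qed.

(** Substituting [L] turns equations of [S] into equations of the preimage, and substituting [L']
    turns them back; the chain rule carries the tangency conditions along. *)
Lemma tangent_space_preimage L L' S x v : L *m L' = 1%:M ->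
  tangent_space ((mulmxr L) @^-1` S) (x *m L') v <-> tangent_space S x (v *m L).
Proof.
move=> LL'; have L'L := mulmx1C LL'; split=> tv f Sf.
  have := tv _ (vanishing_ideal_preimage Sf).
  by rewrite -/(dir_deriv _ _ _) dir_deriv_linear_subst -mulmxA L'L mulmx1.
have Sf' : vanishing_ideal S (linear_subst L' f).
  by rewrite -(mulmxr_preimageK S L'L); apply: vanishing_ideal_preimage.
have := tv _ Sf'.
by rewrite -/(dir_deriv _ _ _) dir_deriv_linear_subst -mulmxA LL' mulmx1.
Qed.

Lemma smooth_point_preimage L L' S x : L *m L' = 1%:M ->
  smooth_point S x -> smooth_point ((mulmxr L) @^-1` S) (x *m L').
Proof.
move=> LL' [Sx [d [chain maxd] [B Bfree BE]]]; have L'L := mulmx1C LL'.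
split; first by rewrite /= -mulmxA L'L mulmx1.
have L'u : L' \in unitmx by case: (mulmx1_unit LL').
have L'free : row_free L' by rewrite row_free_unit.
exists d.
  split; first exact: closed_chain_preimage.
  (* A chain in the preimage pulls back along [L'] to a chain of the same length in [S] through
     [x]. *)
  move=> e /(closed_chain_preimage L'L).
  by rewrite mulmxr_preimageK // -mulmxA L'L mulmx1 => /maxd.
(* [v *m L] lies in the row space of [B] exactly when [v] lies in that of [B *m L']. *)
exists (B *m L'); first by rewrite /row_free mxrankMfree.
move=> v; rewrite (tangent_space_preimage _ _ _ LL') BE.
by rewrite -(submxMfree _ _ L'free) -mulmxA LL' mulmx1.
Qed.

End LinearChange.

(** * Eigenframes of systems of projectors and the form for which they are self-adjoint *)

Section Frames.

(** Rank 1 lets each [p i] be written as a column times a row. Idempotence and orthogonality make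
    these rows the dual basis of these columns, so the matrices [A] of columns and [B] of rows are
    inverse to each other. *)
Lemma rank1_frame (F : fieldType) n (p : 'I_n -> 'M[F]_n) :
    (forall i, p i *m p i = p i) -> (forall i, \rank (p i) = 1%N) ->
    (forall i k, i != k -> p i *m p k = 0) ->
  exists A B : 'M[F]_n,
    A *m B = 1%:M /\ forall i, p i = A *m delta_mx i i *m B.
Proof.
move=> pp rk orth.
have /choice [ab abE] i : exists ab : 'cV[F]_n * 'rV[F]_n,
    p i = ab.1 *m ab.2.
  have := mulmx_base (p i); move: (col_base _) (row_base _).
  by rewrite rk => a b <-; exists (a, b).
pose A := \matrix_(k, i) (ab i).1 k ord0.
pose B := \matrix_(i, k) (ab i).2 ord0 k.
have pE i : p i = col i A *m row i B.
  rewrite abE; congr (_ *m _).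
    by apply/matrixP=> k l; rewrite !mxE ord1.
  by apply/matrixP=> k l; rewrite !mxE ord1.
have mulp i k : p i *m p k = (B *m A) i k *: (col i A *m row k B).
  rewrite !pE -mulmxA [row i B *m (_ *m _)]mulmxA.
  have -> : row i B *m col k A = ((B *m A) i k)%:M.
    by apply/matrixP=> r s; rewrite !ord1 !mxE eqxx; apply: eq_bigr => l _;
      rewrite !mxE.
  by rewrite mul_scalar_mx -scalemxAr.
have pn0 i : p i != 0 by rewrite -mxrank_eq0 rk.
have diag i : (B *m A) i i = 1.
  have /eqP := mulp i i; rewrite pp -pE -subr_eq0 -{1}[p i]scale1r -scalerBl.
  by rewrite scaler_eq0 (negPf (pn0 i)) orbF subr_eq0 => /eqP.
have BA : B *m A = 1%:M.
  apply/matrixP=> i k; rewrite [RHS]mxE; have [<-|ik] := eqVneq i k.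
    exact: diag.
  have /eqP := mulp i k; rewrite orth // eq_sym scaler_eq0 => /orP [/eqP //|].
  (* In the remaining case [col i A *m row k B] is zero; but between [row i B] and [col k A] it
     becomes 1, by [diag]. *)
  move=> /eqP /(congr1 (fun M => row i B *m M *m col k A)) /eqP.
  rewrite mulmx0 mul0mx mulmxA -mulmxA.
  have rc l : row l B *m col l A = 1%:M.
    by rewrite -(diag l); apply/matrixP=> r s; rewrite !ord1 !mxE eqxx;
      apply: eq_bigr => t _; rewrite !mxE.
  by rewrite !rc mulmx1 -mxrank_eq0 mxrank1.
exists A, B; split=> [|i]; first exact: mulmx1C.
by rewrite pE rowE colE !mulmxA -[A *m _ *m _]mulmxA mul_delta_mx.
Qed.

Lemma mxtrace_delta (R : comNzRingType) n (X Y : 'M[R]_n) i j :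
  \tr (delta_mx i i *m X *m (delta_mx j j *m Y)) = X i j * Y j i.
Proof.
(* Factoring both [delta_mx] through dimension 1 leaves the trace of a product of two 1 by 1
   matrices. *)
rewrite -(mul_delta_mx (0 : 'I_1) i i) -(mul_delta_mx (0 : 'I_1) j j).
rewrite -!mulmxA mxtrace_mulC.
have -> : delta_mx (0 : 'I_1) i
    *m (X *m (delta_mx j 0 *m (delta_mx (0 : 'I_1) j *m Y)))
    *m delta_mx i (0 : 'I_1)
  = (row i X *m delta_mx j (0 : 'I_1)) *m (row j Y *m delta_mx i (0 : 'I_1)).
  by rewrite !rowE !mulmxA.
by rewrite trace_mx11 mxE big_ord1 -!colE !mxE.
Qed.

Context {C : numClosedFieldType}.

Lemma trmxC_mul m n r (A : 'M[C]_(m, n)) (B : 'M[C]_(n, r)) :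
  (A *m B)^t* = B^t* *m A^t*.
Proof. by rewrite trmx_mul map_mxM. Qed.

Lemma trmxC1 n : (1%:M : 'M[C]_n)^t* = 1%:M.
Proof. by rewrite trmx1 map_mx1. Qed.

Lemma unitmx_trmxC n (A : 'M[C]_n) : (A^t* \in unitmx) = (A \in unitmx).
Proof. by rewrite map_unitmx unitmx_tr. Qed.

(** Self-adjointness of [p k] for the form [g] says that the Gram matrix of the columns of [A]
    commutes with [delta_mx k k]; hence this matrix is diagonal. *)
Lemma frame_gram_diag n (p : 'I_n -> 'M[C]_n) (A B g : 'M[C]_n) :
    A *m B = 1%:M -> (forall i, p i = A *m delta_mx i i *m B) ->
    (forall i, g *m p i = (p i)^t* *m g) ->
  forall i k, i != k -> (A^t* *m g *m A) i k = 0.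
Proof.
move=> AB pE gp i k ik; have BA := mulmx1C AB.
have ABs : B^t* *m A^t* = 1%:M by rewrite -trmxC_mul AB trmxC1.
have BAs : A^t* *m B^t* = 1%:M by rewrite -trmxC_mul BA trmxC1.
have /(congr1 (fun M => (A^t* *m M *m A) i k)) := gp k.
have -> : A^t* *m (g *m p k) *m A = A^t* *m g *m A *m delta_mx k k.
  by rewrite pE !mulmxA -[_ *m B *m A]mulmxA BA mulmx1.
have -> : A^t* *m ((p k)^t* *m g) *m A
    = (delta_mx k k)^t* *m (A^t* *m g *m A).
  by rewrite pE !trmxC_mul !mulmxA BAs mul1mx.
rewrite !mxE (bigD1 k) //= big1 => [|l lk].
  rewrite big1 => [|l _]; rewrite !mxE ?eqxx ?mulr1 ?addr0 //.
  by rewrite (negPf ik) andbF conjC0 mul0r.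
by rewrite !mxE (negPf lk) mulr0.
Qed.

Lemma diag_unitmx_neq0 n (D : 'M[C]_n) i :
  D \in unitmx -> (forall k, i != k -> D i k = 0) -> D i i != 0.
Proof.
move=> Du D0; apply/eqP => Dii.
have /matrixP /(_ i i) := mulmxV Du.
rewrite !mxE eqxx big1 => [/esym/eqP|k _]; first by rewrite oner_eq0.
by have [<-|ik] := eqVneq i k; rewrite ?Dii ?D0 // mul0r.
Qed.

(* In frames of eigenvectors the form [g] has diagonal Gram matrices [D] and
   [D'], and [D' j j / n = `|W i j| ^ 2 * D i i], where [W] is the transition
   matrix: all the ratios [D i i / D' j j] are positive. *)
Lemma unbiased_form_definite n (p q : 'I_n -> 'M[C]_n) (g : 'M[C]_n) :
    (forall i, p i *m p i = p i) -> (forall i, \rank (p i) = 1%N) ->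
    (forall i k, i != k -> p i *m p k = 0) ->
    (forall i, q i *m q i = q i) -> (forall i, \rank (q i) = 1%N) ->
    (forall i k, i != k -> q i *m q k = 0) ->
    (forall i j, \tr (p i *m q j) = n%:R^-1) ->
    g \in unitmx -> (forall i, g *m p i = (p i)^t* *m g) ->
    (forall j, g *m q j = (q j)^t* *m g) ->
  exists h c, [/\ h \in unitmx, c != 0 & h^t* *m h = c *: g].
Proof.
move=> pp prk po qq qrk qo tr gu gp gq.
(* In dimension 0 the identity serves; afterwards the index 0, used to define [c], exists. *)
case: n => [|n] in p q g pp prk po qq qrk qo tr gu gp gq *.
  by exists 1%:M, 1; split; rewrite ?unitmx1 ?oner_eq0 ?flatmx0.
have [A [B [AB pE]]] := rank1_frame pp prk po.
have [A' [B' [AB' qE]]] := rank1_frame qq qrk qo.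
have BA := mulmx1C AB; have BA' := mulmx1C AB'.
have ABs : B^t* *m A^t* = 1%:M by rewrite -trmxC_mul AB trmxC1.
pose D := A^t* *m g *m A; pose D' := A'^t* *m g *m A'; pose W := B *m A'.
have Dd := frame_gram_diag AB pE gp; rewrite -/D in Dd.
have Dd' := frame_gram_diag AB' qE gq; rewrite -/D' in Dd'.
have D'u : D' \in unitmx.
  by have [A'u _] := mulmx1_unit AB'; rewrite !unitmx_mul unitmx_trmxC gu A'u.
have gE : g = B^t* *m D *m B.
  by rewrite /D !mulmxA ABs mul1mx -mulmxA AB mulmx1.
have trE i j : W i j * (B' *m A) j i = n.+1%:R^-1.
  rewrite -(tr i j) pE qE -mxtrace_delta -!mulmxA.
  by rewrite [RHS]mxtrace_mulC !mulmxA.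
have ratio i j : D' j j / n.+1%:R = `|W i j| ^+ 2 * D i i.
  (* Both sides are [A'^t* *m g *m A]. As [D] and [D'] are diagonal, each side of the entry at [j],
     [i] is a single product; multiplying by [W i j] and using [trE] gives the ratio. *)
  have /matrixP /(_ j i) : D' *m (B' *m A) = W^t* *m D.
    by rewrite /D' /W /D trmxC_mul !mulmxA -[_ *m A' *m B']mulmxA AB' mulmx1
      -[_ *m B^t* *m A^t*]mulmxA ABs mulmx1.
  rewrite [LHS]mxE [RHS]mxE (bigD1 j) //= big1 => [|k kj]; last first.
    by rewrite Dd' ?mul0r // eq_sym.
  rewrite (bigD1 i) //= big1 => [|k ki]; last by rewrite Dd // mulr0.
  rewrite !addr0 [(W^t*) _ _]mxE [W^T _ _]mxE => E.
  by rewrite -(trE i j) mulrCA E normCK mulrA.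
clearbody D D' W.
have D'0 j : D' j j != 0 by apply: diag_unitmx_neq0 => // k; apply: Dd'.
(* By [ratio] with [j = 0], [D] is [c] times the positive diagonal matrix with entries
   [|W i 0| ^- 2]. The square root of the latter enters [h]. *)
pose c := D' 0 0 / n.+1%:R.
have c0 : c != 0 by rewrite mulf_neq0 // invr_eq0 pnatr_eq0.
have W0 i : `|W i 0| != 0.
  by apply: contraNneq c0 => Wi; rewrite /c (ratio i) Wi expr0n mul0r.
pose h := diag_mx (\row_i `|W i 0|^-1) *m B.
have hh : h^t* *m h = c^-1 *: g.
  rewrite /h trmxC_mul gE -!mulmxA scalemxAr.
  congr (_ *m _); rewrite mulmxA scalemxAl; congr (_ *m _).
  rewrite tr_diag_mx map_diag_mx mulmx_diag; apply/matrixP=> i k.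
  rewrite !mxE.
  have [<-|ik] := eqVneq i k; last by rewrite Dd // mulr0.
  have Di0 : D i i != 0.
    by have := c0; rewrite /c (ratio i) mulf_eq0 negb_or => /andP [].
  rewrite /c (ratio i) invfM mulfVK // mulr1n /=.
  by rewrite conj_Creal ?rpredV ?normr_real // -expr2 exprVn.
exists h, c^-1; split; rewrite ?invr_eq0 //.
have : h^t* *m h \in unitmx.
  by rewrite hh unitmxE detZ unitrM unitrX ?unitfE ?invr_eq0 // -unitfE -unitmxE.
by rewrite unitmx_mul => /andP [].
Qed.

(** [h] is an isometry from the form [h^t* *m h] to the standard one, so it carries operators
    self-adjoint for the former to Hermitian ones. *)
Lemma conj_hermsym n (h p : 'M[C]_n) : h \in unitmx ->
    (h^t* *m h) *m p = p^t* *m (h^t* *m h) ->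
  h *m p *m invmx h \is hermsymmx.
Proof.
move=> hu hp; apply/is_hermitianmxP; rewrite expr0 scale1r.
have hsu : h^t* \in unitmx by rewrite unitmx_trmxC.
apply: (can_inj (mulKmx hsu)); apply: (can_inj (mulmxK hu)).
have hV : h^t* *m (invmx h)^t* = 1%:M by rewrite -trmxC_mul mulVmx // trmxC1.
by rewrite !mulmxA mulmxKV // hp !trmxC_mul !mulmxA hV mul1mx.
Qed.

End Frames.

(** * Orbits under conjugation, the involution [theta] and its fixed points *)

Section Moduli.
Context {R : realType} {n : nat}.
Local Notation C := R[i].
Implicit Types (x y : projsys R n) (g h : 'M[C]_n).

Lemma conj_byM g h x : g \in unitmx -> h \in unitmx ->
  conj_by g (conj_by h x) = conj_by (g *m h) x.
Proof.
move=> gu hu; have ghV : invmx (g *m h) = invmx h *m invmx g.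
  have ghu : g *m h \in unitmx by rewrite unitmx_mul gu.
  apply: (can_inj (mulKmx ghu)).
  by rewrite mulmxV // mulmxA mulmxK // mulmxV.
by rewrite /conj_by ghV /=; congr (_, _); apply/funext => i; rewrite !mulmxA.
Qed.

Lemma conj_by1 x : conj_by 1%:M x = x.
Proof.
by case: x => p q; congr (_, _); apply/funext => i /=;
  rewrite mul1mx invmx1 mulmx1.
Qed.

Lemma GL_orbit_refl x : GL_orbit x x.
Proof. by exists 1%:M; [exact: unitmx1 | exact: conj_by1]. Qed.

Lemma GL_orbit_conj g x : g \in unitmx -> GL_orbit (conj_by g x) = GL_orbit x.
Proof.
move=> gu; rewrite eqEsubset; split=> _ [h hu <-] /=.
  by exists (h *m g); rewrite /= ?unitmx_mul ?hu // conj_byM.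
have gVu : invmx g \in unitmx by rewrite unitmx_inv.
have hgVu : h *m invmx g \in unitmx by rewrite unitmx_mul hu.
by exists (h *m invmx g) => //; rewrite conj_byM // mulmxKV.
Qed.

Lemma GL_saturation_U_orbit x : GL_saturation (U_orbit x) = GL_orbit x.
Proof.
rewrite eqEsubset; split=> y.
  by case=> z [u uu <-]; rewrite GL_orbit_conj ?unitarymx_unit.
move=> xy; exists x => //; exists 1%:M; last exact: conj_by1.
by apply/unitarymxP; rewrite trmxC1 mulmx1.
Qed.

Lemma adjoint_conj g x :
  g \in unitmx -> adjoint (conj_by g x) = conj_by ((invmx g)^t*) (adjoint x).
Proof.
move=> gu; have gV : invmx ((invmx g)^t*) = g^t*.
  by rewrite -map_invmx trmx_inv invmxK.
by rewrite /adjoint /conj_by gV /=; congr (_, _); apply/funext => i;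
  rewrite !trmxC_mul mulmxA.
Qed.

Lemma adjointK : involutive (@adjoint R n).
Proof.
by case=> p q; rewrite /adjoint /=; congr (_, _); apply/funext => i;
  rewrite trmxCK.
Qed.

(** The adjoint turns conjugation by [g] into conjugation by the conjugate transpose of [invmx g],
    which again runs over all invertible matrices. *)
Lemma theta_GL_orbit x : theta (GL_orbit x) = GL_orbit (adjoint x).
Proof.
rewrite eqEsubset; split=> [_ [_ [g gu <-] <-]|_ [g gu <-]] /=.
  by rewrite adjoint_conj //; exists ((invmx g)^t*) => //;
    rewrite /= unitmx_trmxC unitmx_inv.
exists (adjoint (conj_by g (adjoint x))); last exact: adjointK.
rewrite adjoint_conj // adjointK; exists ((invmx g)^t*) => //.
by rewrite /= unitmx_trmxC unitmx_inv.
Qed.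

Lemma configurations_conj g x :
  g \in unitmx -> configurations R n x -> configurations R n (conj_by g x).
Proof.
move=> gu.
have mulc (a b : 'M[C]_n) :
    g *m a *m invmx g *m (g *m b *m invmx g) = g *m (a *m b) *m invmx g.
  by rewrite !mulmxA mulmxKV.
have rank1_conj a : rank1_projector a -> rank1_projector (g *m a *m invmx g).
  move=> [aa rka]; split; first by rewrite mulc aa.
  by rewrite mxrankMfree ?row_free_unit ?unitmx_inv // eqmxMfull ?row_full_unit.
case: x => p q [[pr qr] po qo tr]; split=> /=.
- by split=> i; apply: rank1_conj.
- by move=> i k /po ik; rewrite mulc ik mulmx0 mul0mx.
- by move=> i k /qo ik; rewrite mulc ik mulmx0 mul0mx.
- by move=> i j; rewrite mulc mxtrace_mulC mulKmx //; apply: tr.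
Qed.

(** The matrix of [conj_by g] on [coords]. The inner [lin_mx] acts on one flattened projector, [K]
    applies it to every projector of a system, and the two blocks treat the two systems. *)
Definition conj_mx g : 'M[C]_(n * (n * n) + n * (n * n)) :=
  let K := lin_mx (mulmxr (lin_mx (mulmxr (invmx g) \o mulmx g))) in
  block_mx K 0 0 K.

Lemma coords_conj g x : coords (conj_by g x) = coords x *m conj_mx g.
Proof.
rewrite /coords mul_row_block !mulmx0 addr0 add0r !mul_vec_lin /=.
by congr (row_mx (mxvec _) (mxvec _)); apply/row_matrixP => i;
  rewrite row_mul !rowK mul_vec_lin.
Qed.

Lemma conj_mxK g : g \in unitmx -> conj_mx g *m conj_mx (invmx g) = 1%:M.
Proof.
move=> gu.
have conjK : lin_mx (mulmxr (invmx g) \o mulmx g)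
    *m lin_mx (mulmxr (invmx (invmx g)) \o mulmx (invmx g)) = 1%:M.
  apply/row_matrixP => i; rewrite !rowE mulmx1 mulmxA !mul_rV_lin /= mxvecK.
  by rewrite invmxK !mulmxA mulVmx // mul1mx mulmxKV // vec_mxK.
rewrite /conj_mx mulmx_block !mulmx0 !mul0mx !addr0 add0r.
rewrite [RHS](@scalar_mx_block C (n * (n * n)) (n * (n * n))).
by congr (block_mx _ _ _ _);
  apply/row_matrixP => i; rewrite !rowE mulmx1 mulmxA !mul_rV_lin /= mxvecK;
  rewrite -mulmxA conjK mulmx1 vec_mxK.
Qed.

(** In coordinates, the set of configurations is its own preimage under conjugation by [invmx g], an
    invertible linear map. *)
Lemma smooth_conj g x : g \in unitmx ->
  smooth_configurations R n x -> smooth_configurations R n (conj_by g x).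
Proof.
move=> gu [cx sx]; split; first exact: configurations_conj.
have gVu : invmx g \in unitmx by rewrite unitmx_inv.
have KV : conj_mx (invmx g) *m conj_mx g = 1%:M.
  by rewrite -{2}[g]invmxK conj_mxK.
have -> : @coords R n @` configurations R n =
    (mulmxr (conj_mx (invmx g))) @^-1` (@coords R n @` configurations R n).
  rewrite eqEsubset; split=> [_ [y cy <-]|y [z cz zy]].
    exists (conj_by (invmx g) y); first exact: configurations_conj.
    by rewrite coords_conj.
  exists (conj_by g z); first exact: configurations_conj.
  by rewrite coords_conj zy /= -mulmxA KV mulmx1.
by rewrite coords_conj; apply: smooth_point_preimage.
Qed.

Lemma hermitian_adjoint x :
    (forall i, x.1 i \is hermsymmx) -> (forall j, x.2 j \is hermsymmx) ->
  adjoint x = x.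
Proof.
case: x => p q /= hp hq; congr (_, _); apply/funext => i /=.
  by have /is_hermitianmxP := hp i; rewrite expr0 scale1r => <-.
by have /is_hermitianmxP := hq i; rewrite expr0 scale1r => <-.
Qed.

(** A fixed orbit contains the adjoint of [x], which yields [g] with [g p = p^t* g] for all the
    projectors. Up to a nonzero scalar [g] is [h^t* *m h], and this [h] serves. *)
Lemma theta_fixed_hermitian x : configurations R n x ->
    theta (GL_orbit x) = GL_orbit x ->
  exists2 h, h \in unitmx & (forall i, (conj_by h x).1 i \is hermsymmx) /\
    (forall j, (conj_by h x).2 j \is hermsymmx).
Proof.
case: x => p q [[pr qr] po qo tr]; rewrite theta_GL_orbit => fix_x.
have : GL_orbit (p, q) (adjoint (p, q)).
  by rewrite -fix_x; apply: GL_orbit_refl.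
case=> g gu [gp gq].
have gpE i : g *m p i = (p i)^t* *m g.
  by rewrite -[(p i)^t*](congr1 (fun f => f i) gp) mulmxKV.
have gqE i : g *m q i = (q i)^t* *m g.
  by rewrite -[(q i)^t*](congr1 (fun f => f i) gq) mulmxKV.
have [h [c [hu c0 hh]]] := unbiased_form_definite
  (fun i => (pr i).1) (fun i => (pr i).2) po
  (fun i => (qr i).1) (fun i => (qr i).2) qo tr gu gpE gqE.
exists h => //; split=> i; apply: conj_hermsym => //; rewrite hh.
  by rewrite -scalemxAl -scalemxAr gpE.
by rewrite -scalemxAl -scalemxAr gqE.
Qed.

(** A Hermitian configuration is its own adjoint, so its orbit is fixed. Conversely a fixed smooth
    orbit contains a Hermitian configuration, which is smooth because smoothness is invariant under
    conjugation. *)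
Lemma moduli_real_in_thetaE : moduli_real_in_theta R n = moduli_theta R n.
Proof.
rewrite eqEsubset; split=> m.
  case=> _ [x [xs xp xq] <-] <-; rewrite GL_saturation_U_orbit; split.
    by exists x.
  by rewrite theta_GL_orbit hermitian_adjoint.
case=> -[x xs <-] fix_x.
have [h hu [hp hq]] := theta_fixed_hermitian xs.1 fix_x.
exists (U_orbit (conj_by h x)).
  by exists (conj_by h x) => //; split=> //; apply: smooth_conj.
by rewrite GL_saturation_U_orbit GL_orbit_conj.
Qed.

End Moduli.

Theorem corollary21 (R : realType) (n : nat) :
  open_in (moduli_theta R n) (moduli_real_in_theta R n) /\
  exists (k : nat) (phi : 'I_k -> set (projsys R n) -> R[i]),
    (forall a, real_regular_function (phi a)) /\
    moduli_real_in_theta R n =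
      [set m | moduli_theta R n m /\ forall a, 0 < phi a m].
Proof.
rewrite moduli_real_in_thetaE; split.
  (* The subset is the whole of [moduli_theta], cut out by the open set of all points. *)
  by exists setT; [exact: openT | rewrite setIT].
(* The family is indexed by the empty type ['I_0]; the value 0 is only a filler. *)
exists 0%N, (fun _ _ => 0); split; first by case.
by rewrite eqEsubset; split=> [m mm|m []] //; split=> // -[].
Qed.
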